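(* Let $A_1=P_1J_1P_1^{-1}$ with $J_1=\mathrm{diag}(-p_1,-q_1)$, $0<p_1\le q_1$, and $A_2=P_2J_2P_2^{-1}$ with $J_2=\begin{pmatrix}n_2&1\\0&n_2\end{pmatrix}$, $n_2\ge0$; here $P_1,P_2$ are real invertible $2\times 2$ matrices chosen such that $M=P_2^{-1}P_1=\begin{pmatrix}a&b\\c&d\end{pmatrix}$ has determinant $1$. Let $\eta>0$ be given. (i) If $cd=0$, let $\tau_{1,2}(\eta)=\frac{n_2}{p_1}\eta+\epsilon_0$, for any $\epsilon_0>0$. (ii) If $cd\ne0$ and $cd\notin(-n_2,0]$, let $\tau_{1,2}(\eta)$ be the unique positive solution $t$ of $$|cd|\,\eta\cosh\left(\frac{q_1-p_1}{2}\,t\right)=-\sinh\left(n_2\eta-\frac{q_1+p_1}{2}\,t\right)-\mathrm{sgn}(cd)\sinh\left(\frac{q_1-p_1}{2}\,t\right).$$ (iii) If $cd\in(-n_2,0)$, let $\tau_{1,2}(\eta)=\max\{\tau_+(\eta),\tau_-(\eta)\}$, where $\tau_+(\eta)$ and $\tau_-(\eta)$ are the unique positive solutions $t$ of, respectively, $$\sinh\left(\frac{q_1-p_1}{2}\,t\right)=\sinh\left(\frac{q_1+p_1}{2}\,t-n_2\eta\right)$$ and $$cd\,\eta\cosh\left(\frac{q_1-p_1}{2}\,t\right)=-\sinh\left(\frac{q_1-p_1}{2}\,t\right)-\sinh\left(\frac{q_1+p_1}{2}\,t-n_2\eta\right).$$ Then the switched system $\dot x(t)=A_{\sigma(t)}x(t)$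 is stable for all $\sigma\in\mathcal S[\tau_{1,2}(\eta),\eta]$ and asymptotically stable for all $\sigma\in\mathcal S'[\tau_{1,2}(\eta),\eta]$.
   Context: Planar switched system: $\dot x(t)=A_{\sigma(t)}x(t)$, $x(t)\in\mathbb R^2$ continuous in $t\ge0$, with $A_1,A_2$ real $2\times2$ matrices. A switching signal $\sigma:[0,\infty)\to\{1,2\}$ is right-continuous and piecewise constant with infinitely many discontinuities $0<d_1<d_2<\cdots$, $d_k\to\infty$; set $d_0=0$. For a signal with $\sigma(0)=1$ put $t_k=d_{2k-1}-d_{2k-2}$ (times spent in $A_1$) and $s_k=d_{2k}-d_{2k-1}$ (times spent in $A_2$), $k\ge1$. For $\tau,\eta>0$, $\mathcal S[\tau,\eta]$ is the set of signals with $\sigma(0)=1$, $t_k\ge\tau$ and $s_k\le\eta$ for all $k\in\mathbb N$; $\mathcal S'[\tau,\eta]$ is the set of $\sigma\in\mathcal S[\tau,\eta]$ for which the sequence $(t_k,s_k)_{k\ge1}$ does not converge to $(\tau,\eta)$. For a given signal $\sigma$, the system is stable if for every $\varepsilon'>0$ there is $\delta>0$ such that $\|x(0)\|<\delta$ implies $\|x(t)\|<\varepsilon'$ for all $t>0$; it is asymptotically stable if it is stable and $\|x(t)\|\to0$ as $t\to\infty$ for every $x(0)\in\mathbb R^2$. Norms are Euclidean. *)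

(* Defs.v *)
From mathcomp Require Import all_boot all_order all_algebra.
From mathcomp Require Import all_classical all_reals all_analysis.

Set Implicit Arguments.
Unset Strict Implicit.
Unset Printing Implicit Defensive.

Import Order.TTheory GRing.Theory Num.Theory.
Import numFieldNormedType.Exports.

Local Open Scope classical_set_scope.
Local Open Scope ring_scope.

Section Hyperbolic.
Variable R : realType.

Definition cosh (x : R) : R := (expR x + expR (- x)) / 2.
Definition sinh (x : R) : R := (expR x - expR (- x)) / 2.

End Hyperbolic.

Section PlanarMatrices.
Variable R : realType.

Definition mx2 (a b c d : R) : 'M[R]_2 :=
  \matrix_(i < 2, j < 2)
    if i == 0 then (if j == 0 then a else b) else (if j == 0 then c else d).

(* The norm that the library puts on matrices is the sup norm. *)
Definition enorm (x : 'cV[R]_2) : R := Num.sqrt (\sum_(i < 2) x i 0 ^+ 2).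

End PlanarMatrices.

Variant mode := mode1 | mode2.

Section SwitchedSystem.
Variable R : realType.

(* Right-continuous, piecewise constant functions on [0, +oo[ whose
   discontinuities are exactly d_1 < d_2 < ..., with d_k --> +oo; d_0 = 0 is
   not a discontinuity. Only the values [sig t] with 0 <= t matter. *)
Record signal := Signal {
  sig :> R -> mode ;
  switch_time : nat -> R ;
  switch_time0 : switch_time 0 = 0 ;
  switch_time_incr : forall k, switch_time k < switch_time k.+1 ;
  switch_time_cvg : switch_time k @[k --> \oo] --> +oo ;
  sig_const : forall k t, switch_time k <= t < switch_time k.+1 ->
    sig t = sig (switch_time k) ;
  sig_switch : forall k, sig (switch_time k.+1) <> sig (switch_time k) }.

(* For a signal starting in mode 1: the (k+1)-th time intervals spent in mode 1
   and in mode 2 last [dwell1 s k] and [dwell2 s k], for k >= 0. *)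
Definition dwell1 (s : signal) (k : nat) : R :=
  switch_time s (2 * k).+1 - switch_time s (2 * k).
Definition dwell2 (s : signal) (k : nat) : R :=
  switch_time s (2 * k).+2 - switch_time s (2 * k).+1.

Definition dwell_class (tau eta : R) : set signal :=
  [set s : signal | s 0 = mode1 /\
    forall k, tau <= dwell1 s k /\ dwell2 s k <= eta].

Definition dwell_class' (tau eta : R) : set signal :=
  [set s : signal | dwell_class tau eta s /\
    ~ ((dwell1 s k, dwell2 s k) @[k --> \oo] --> (tau, eta))].

Variables A1 A2 : 'M[R]_2.

Definition mode_mx (m : mode) : 'M[R]_2 := if m is mode1 then A1 else A2.

(* The differential equation is required off the switching times, where the
   velocity of a trajectory may jump. *)
Definition trajectory (s : signal) (x : R -> 'cV[R]_2) : Prop :=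
  {within `[0, +oo[, continuous x} /\
  forall t : R, 0 < t -> (forall k, t <> switch_time s k) ->
    is_derive t 1 x (mode_mx (s t) *m x t).

Definition stable (s : signal) : Prop :=
  forall eps : R, 0 < eps -> exists2 delta : R, 0 < delta &
    forall x, trajectory s x -> enorm (x 0) < delta ->
      forall t : R, 0 < t -> enorm (x t) < eps.

Definition asymptotically_stable (s : signal) : Prop :=
  stable s /\
  forall x, trajectory s x -> enorm (x t) @[t --> +oo] --> 0.

End SwitchedSystem.

(* Main.v *)
Require Import Defs.
From mathcomp Require Import all_boot all_order all_algebra.
From mathcomp Require Import all_classical all_reals all_analysis.
From mathcomp Require Import ring lra.

Set Implicit Arguments.
Unset Strict Implicit.
Unset Printing Implicit Defensive.

Import Order.TTheory GRing.Theory Num.Theory.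
Import numFieldNormedType.Exports.

Local Open Scope classical_set_scope.
Local Open Scope ring_scope.

(** Let [p <= q] be the decay rates of mode 1, [n] the growth rate of mode 2 and
    [k = c * d]. In the basis of eigenvectors of [A1], suitably rescaled, mode 1
    flows by [diag (exp (- p t), exp (- q t))] and mode 2 by
    [exp (n s) (1 + s K)], where [K = mx2 k g (- h) (- k)] is nilpotent. Rescaling
    the two axes changes [g] and [h] but not [g * h = k ^ 2]
    ([normal_form]). If [k != 0] one can take [g = h = k].

    A cycle spends a time [t >= tau] in mode 1 and then [s <= eta] in mode 2.
    Measure the state at the start of each cycle after an additional half of
    [tau] in mode 1. The cycle then acts as a contraction with factor
    [exp (- p (t - tau))] followed by
      [G s = D (exp (n s) (1 + s K)) D],  [D] the flow of mode 1 for [tau / 2].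
    If the Euclidean operator norm of [G s] is at most 1 for [0 <= s <= eta],
    this energy never increases and, being equivalent to the norm up to
    constants uniform over a cycle, gives stability. If moreover the norm of
    [G s] stays away from 1 as long as [s] stays away from [eta], then whenever
    [(t, s)] does not converge to [(tau, eta)] infinitely many cycles contract
    by a fixed factor, and the energy tends to 0 ([energy_contracts_often],
    [cvg0_contract_often]).

    For [g = h = k] put [al = (q - p) tau / 2], [be s = (q + p) tau / 2 - n s] and
    [S s = sinh al + s k cosh al]. Up to the scalar [exp (- be s)], [G s] is the
    product of the reflection [diag (1, -1)] and a symmetric matrix of
    determinant -1 and trace [2 S s]. Its norm is therefore
    [exp (arsinh |S s| - be s)], and the requirement is [|S s| <= sinh (be s)]
    ([enorm_reflect_le], [stabilizes_coupled]). At [s = eta] the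
    threshold equations express the critical one of the two bounds on [S s]; for
    [- n < k < 0] there is one more equation, which says [al = be eta].
    [stabilizes_pos] and [stabilizes_neg] derive from these conditions at
    [s = eta] the bounds for all shorter times. The equations that bound
    [S eta], divided by [cosh al], equate a constant with a strictly increasing
    function of [tau], whence existence,
    uniqueness, and validity beyond the threshold ([threshold_exists_unique],
    [threshold_le]).

    For [k = 0] the matrix [G s] is triangular, its diagonal entries are at most
    [exp (- p eps)] where [eps] is the excess of [tau] over [n eta / p], and the
    rescaling makes the off-diagonal entry as small as desired
    ([stabilizes_triangular]). *)

(** * Hyperbolic functions *)

Section Hyperbolic.
Variable R : realType.
Implicit Types x y t : R.

Lemma sinhN x : sinh (- x) = - sinh x.
Proof. by rewrite /sinh opprK; ring. Qed.

Lemma sinh0 : sinh 0 = 0 :> R.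
Proof. by rewrite /sinh oppr0 subrr mul0r. Qed.

Lemma sinhD x y : sinh (x + y) = sinh x * cosh y + cosh x * sinh y.
Proof. by rewrite /sinh /cosh opprD !expRD; field. Qed.

Lemma coshD x y : cosh (x + y) = cosh x * cosh y + sinh x * sinh y.
Proof. by rewrite /sinh /cosh opprD !expRD; field. Qed.

Lemma coshN x : cosh (- x) = cosh x.
Proof. by rewrite /cosh opprK addrC. Qed.

Lemma cosh2B_sinh2 x : cosh x ^+ 2 - sinh x ^+ 2 = 1.
Proof.
rewrite /sinh /cosh expRN; field.
by rewrite gt_eqF ?expR_gt0.
Qed.

Lemma cosh_gt0 x : 0 < cosh x.
Proof. by rewrite /cosh divr_gt0 ?addr_gt0 ?expR_gt0. Qed.

Lemma cosh_ge1 x : 1 <= cosh x.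
Proof. have := cosh2B_sinh2 x; have := cosh_gt0 x; nra. Qed.

Lemma cosh_addsinh x : cosh x + sinh x = expR x.
Proof. by rewrite /cosh /sinh; field. Qed.

Lemma ltr_sinh : {mono @sinh R : x y / x < y}.
Proof.
apply: leW_mono; apply: le_mono => x y xy.
rewrite /sinh ltr_pM2r ?invr_gt0// ltrB ?ltr_expR// ltrN2//.
Qed.

Lemma ler_sinh : {mono @sinh R : x y / x <= y}.
Proof. by move=> x y; rewrite !leNgt ltr_sinh. Qed.

Lemma sinh_inj : injective (@sinh R).
Proof. exact: inc_inj ler_sinh. Qed.

Lemma sinh_ge0 x : 0 <= x -> 0 <= sinh x.
Proof. by rewrite -{2}sinh0 ler_sinh. Qed.

Lemma ler_cosh x y : `|x| <= y -> cosh x <= cosh y.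
Proof.
move=> xy; have y0 : 0 <= y by apply: le_trans xy.
have : `|sinh x| <= sinh y.
  by move: xy; rewrite !ler_norml -sinhN !ler_sinh.
rewrite ler_norml => /andP[s1 s2].
have := cosh2B_sinh2 x; have := cosh2B_sinh2 y.
have := cosh_gt0 x; have := cosh_gt0 y; nra.
Qed.

Global Instance is_derive_sinh x : is_derive x 1 (@sinh R) (cosh x).
Proof.
have -> : @sinh R = fun y => 2^-1 *: (expR y - expR (- y)).
  by apply/funext => y; rewrite /sinh mulrC.
apply: is_derive_eq.
by rewrite /cosh mulrN1 opprK /GRing.scale /= mulrC.
Qed.

Lemma continuous_sinh : continuous (@sinh R).
Proof.
by move=> x; apply/differentiable_continuous/derivable1_diffP.
Qed.

Lemma continuous_cosh : continuous (@cosh R).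
Proof.
move=> x; rewrite /cosh.
apply: cvgM; last exact: cvg_cst.
apply: cvgD; first exact: continuous_expR.
apply: continuous_comp; [exact: opp_continuous|exact: continuous_expR].
Qed.

(** The hyperbolic sine has slope at most [cosh y] on [[- y, y]]. *)
Lemma sinhB_le x y : `|x| <= y -> sinh y - sinh x <= (y - x) * cosh y.
Proof.
move=> xy; have xy' : x <= y by apply: le_trans xy; exact: ler_norm.
have [c|z /itvP zxy ->] := MVT_segment xy' (fun z _ => is_derive_sinh z).
  exact/continuous_subspaceT/continuous_sinh.
rewrite mulrC ler_wpM2l ?subr_ge0//; apply: ler_cosh.
move: xy; rewrite !ler_norml => /andP[xy _].
by rewrite zxy andbT (le_trans xy)// zxy.
Qed.

(** The hyperbolic sine is convex on the positive half-line. *)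
Lemma sinhB_ge x y : 0 <= x -> x <= y -> (y - x) * cosh x <= sinh y - sinh x.
Proof.
move=> x0 xy.
have [c|z /itvP zxy ->] := MVT_segment xy (fun z _ => is_derive_sinh z).
  exact/continuous_subspaceT/continuous_sinh.
rewrite mulrC ler_wpM2r ?subr_ge0//; apply: ler_cosh.
by rewrite ger0_norm// zxy.
Qed.

End Hyperbolic.

(** * Planar matrices and the Euclidean norm *)

Section PlanarNorm.
Variable R : realType.
Implicit Types (A B : 'M[R]_2) (x y : 'cV[R]_2).

Lemma mx2M (a b c d a' b' c' d' : R) :
  mx2 a b c d *m mx2 a' b' c' d' =
  mx2 (a * a' + b * c') (a * b' + b * d') (c * a' + d * c') (c * b' + d * d').
Proof.
apply/matrixP => i j; rewrite !mxE big_ord_recl big_ord1 !mxE /=.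
by case: (i == 0); case: (j == 0).
Qed.

Lemma mx2_1 : mx2 1 0 0 1 = 1%:M :> 'M[R]_2.
Proof.
apply/matrixP => i j; rewrite !mxE.
by case: i => [[|[|//]] ?]; case: j => [[|[|//]] ?].
Qed.

Lemma det_mx2 (a b c d : R) : \det (mx2 a b c d) = a * d - b * c.
Proof.
rewrite (expand_det_row _ 0) big_ord_recl big_ord1 /cofactor !det_mx11 !mxE /=.
by rewrite addn0 add0n expr0 expr1 mul1r mulN1r mulrN.
Qed.

Lemma sqr_enorm x : enorm x ^+ 2 = x 0 0 ^+ 2 + x 1 0 ^+ 2.
Proof.
rewrite /enorm sqr_sqrtr ?sumr_ge0// => [|i _]; last exact: sqr_ge0.
by rewrite big_ord_recl big_ord1; congr (_ + x _ _ ^+ 2); apply/val_inj.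
Qed.

Lemma enorm_ge0 x : 0 <= enorm x.
Proof. exact: sqrtr_ge0. Qed.

Lemma enorm_le (r : R) x y : 0 <= r ->
  x 0 0 ^+ 2 + x 1 0 ^+ 2 <= r ^+ 2 * (y 0 0 ^+ 2 + y 1 0 ^+ 2) ->
  enorm x <= r * enorm y.
Proof.
move=> r0; rewrite -!sqr_enorm -exprMn ler_sqr//.
  by rewrite nnegrE enorm_ge0.
by rewrite nnegrE mulr_ge0// enorm_ge0.
Qed.

Lemma mulmx_col2 A x i : (A *m x) i 0 = A i 0 * x 0 0 + A i 1 * x 1 0.
Proof.
rewrite mxE big_ord_recl big_ord1.
by congr (_ + A _ _ * x _ _); apply/val_inj.
Qed.

Lemma mulmx_mx2 (a b c d : R) x :
  ((mx2 a b c d *m x) 0 0 = a * x 0 0 + b * x 1 0) *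
  ((mx2 a b c d *m x) 1 0 = c * x 0 0 + d * x 1 0).
Proof. by rewrite !mulmx_col2 !mxE. Qed.

(** The Frobenius bound on the operator norm, by the Cauchy-Schwarz inequality
    on each row. *)
Lemma enorm_mulmx_le A x :
  enorm (A *m x) <=
  Num.sqrt (A 0 0 ^+ 2 + A 0 1 ^+ 2 + A 1 0 ^+ 2 + A 1 1 ^+ 2) * enorm x.
Proof.
apply: enorm_le; first exact: sqrtr_ge0.
rewrite sqr_sqrtr ?addr_ge0 ?sqr_ge0// !mulmx_col2.
have cs (a b u v : R) :
    (a * u + b * v) ^+ 2 <= (a ^+ 2 + b ^+ 2) * (u ^+ 2 + v ^+ 2).
  rewrite -subr_ge0.
  rewrite [leRHS](_ : _ = (a * v - b * u) ^+ 2) ?sqr_ge0//; ring.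
by rewrite -!addrA addrA mulrDl lerD// cs.
Qed.

Lemma enorm_mulmx_bounded A :
  exists2 C : R, 0 < C & forall x, enorm (A *m x) <= C * enorm x.
Proof.
exists (Num.sqrt (A 0 0 ^+ 2 + A 0 1 ^+ 2 + A 1 0 ^+ 2 + A 1 1 ^+ 2) + 1).
  by rewrite ltr_wpDl// sqrtr_ge0.
move=> x; apply: le_trans (enorm_mulmx_le _ _) _.
by rewrite ler_wpM2r ?enorm_ge0// lerDl.
Qed.

Lemma enormZ (a : R) (x : 'cV[R]_2) : 0 <= a -> enorm (a *: x) = a * enorm x.
Proof.
move=> a0; rewrite /enorm -[in RHS](ger0_norm a0) -sqrtr_sqr -sqrtrM ?sqr_ge0//.
by rewrite mulr_sumr; congr Num.sqrt; apply: eq_bigr => i _; rewrite mxE exprMn.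
Qed.

(** The matrix is the sum of a diagonal part and an antidiagonal part, of
    operator norms at most [m] and [m']. *)
Lemma enorm_mx2_le (a b c d m m' : R) (x : 'cV[R]_2) :
  `|a| <= m -> `|d| <= m -> `|b| <= m' -> `|c| <= m' ->
  enorm (mx2 a b c d *m x) <= (m + m') * enorm x.
Proof.
move=> am dm bm cm; have m0 := le_trans (normr_ge0 _) am.
have m'0 := le_trans (normr_ge0 _) bm.
apply: enorm_le; first exact: addr_ge0.
rewrite !mulmx_mx2; move: (x 0 0) (x 1 0) => u v.
have sq (z w : R) : `|z| <= w -> z ^+ 2 <= w ^+ 2.
  move=> zw; rewrite -[z ^+ 2]real_normK ?num_real//.
  by rewrite ler_sqr ?nnegrE// (le_trans _ zw).
have cross (z w : R) : `|z| <= m -> `|w| <= m' ->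
    2 * (z * w) * (u * v) <= m * m' * (u ^+ 2 + v ^+ 2).
  move=> zm wm; have uv : 2 * `|u * v| <= u ^+ 2 + v ^+ 2.
    rewrite normrM -(real_normK (num_real u)) -(real_normK (num_real v)).
    by have := sqr_ge0 (`|u| - `|v|); lra.
  apply: (@le_trans _ _ ((`|z| * `|w|) * (2 * `|u * v|))).
    by have := ler_norm (z * w * (u * v)); rewrite !normrM; lra.
  by rewrite ler_pM ?mulr_ge0// ler_pM.
have := cross _ _ am bm; have := cross _ _ dm cm.
have u2 := sqr_ge0 u; have v2 := sqr_ge0 v.
have := ler_wpM2r u2 (sq _ _ am); have := ler_wpM2r v2 (sq _ _ bm).
have := ler_wpM2r u2 (sq _ _ cm); have := ler_wpM2r v2 (sq _ _ dm).
lra.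
Qed.

(** With [Z = diag(1, -1)] the matrix [Z *m H] is symmetric of determinant -1,
    hence satisfies [(Z *m H) ^ 2 = 2 S (Z *m H) + 1] where [2 S] is its trace.
    So [|H x|^2 = |x|^2 + 2 S <x, Z H x>], and the Cauchy-Schwarz inequality
    bounds [|H x| / |x|] by the positive root [r] of [r ^ 2 = 2 |S| r + 1].
    Here [S = (a - d) / 2]. *)
Lemma enorm_reflect_le (a b d : R) x : a * d + b ^+ 2 = 1 ->
  enorm (mx2 a b (- b) d *m x) <=
  (`|(a - d) / 2| + Num.sqrt (((a - d) / 2) ^+ 2 + 1)) * enorm x.
Proof.
move=> det1; set S := (a - d) / 2; set r := _ + Num.sqrt _.
set y := _ *m x.
have [y0 y1] := mulmx_mx2 a b (- b) d x.
have r0 : 0 < r by rewrite /r ltr_wpDl// sqrtr_gt0 ltr_wpDl// sqr_ge0.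
have rE : r ^+ 2 = 2 * `|S| * r + 1.
  have wE := sqr_sqrtr (addr_ge0 (sqr_ge0 S) (@ler01 R)).
  have SE : `|S| ^+ 2 = S ^+ 2 by rewrite real_normK ?num_real.
  by rewrite /r sqrrD wE -SE; ring.
set w := x 0 0 * y 0 0 - x 1 0 * y 1 0.
have yE : enorm y ^+ 2 = enorm x ^+ 2 + 2 * S * w.
  transitivity ((a * d + b ^+ 2) * enorm x ^+ 2 + 2 * S * w); last first.
    by rewrite det1 mul1r.
  by rewrite !sqr_enorm /w /S y0 y1; field.
have wle : `|w| <= enorm x * enorm y.
  rewrite -ler_sqr ?nnegrE ?mulr_ge0 ?enorm_ge0// exprMn !sqr_enorm.
  rewrite real_normK ?num_real//.
  rewrite -subr_ge0 /w.
  rewrite [leRHS](_ : _ = (x 0 0 * y 1 0 + x 1 0 * y 0 0) ^+ 2) ?sqr_ge0//; ring.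
have Sw : S * w <= `|S| * (enorm x * enorm y).
  by rewrite (le_trans (ler_norm _))// normrM ler_wpM2l.
have X0 := enorm_ge0 x; have Y0 := enorm_ge0 y.
rewrite leNgt; apply/negP => lt.
have : 0 < (enorm y - r * enorm x) * (r * enorm y + enorm x).
  rewrite mulr_gt0 ?subr_gt0// ltr_wpDr// mulr_gt0//.
  by rewrite (le_lt_trans _ lt)// mulr_ge0// ltW.
have : enorm y ^+ 2 - enorm x ^+ 2 <= 2 * `|S| * (enorm x * enorm y).
  by rewrite yE; lra.
rewrite -(ler_pM2l r0).
rewrite (_ : (enorm y - _) * _ = r * (enorm y ^+ 2 - enorm x ^+ 2)
  + (1 - r ^+ 2) * (enorm x * enorm y)); last ring.
rewrite rE; lra.
Qed.

End PlanarNorm.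

(** * Linear planar flows *)

Section LinearFlow.
Variable R : realType.
Implicit Types (A B : 'M[R]_2).

Lemma is_derive_mxP m n (F : R -> 'M[R]_(m, n)) (t : R) (D : 'M[R]_(m, n)) :
  is_derive t 1 F D <->
  forall i j, is_derive t 1 (fun s => F s i j) (D i j).
Proof.
split=> [[dF FD] i j|FD].
  split; first by have /derivable_mxP := dF; exact.
  by rewrite -FD derive_mx// mxE.
have dF : derivable F t 1.
  by apply/derivable_mxP => i j; have [] := FD i j.
split=> //; rewrite derive_mx//; apply/matrixP => i j; rewrite mxE.
exact: derive_val.
Qed.

Lemma is_derive_mulmx (F : R -> 'M[R]_2) (y : R -> 'cV[R]_2) (t : R) D v :
  is_derive t 1 F D -> is_derive t 1 y v ->
  is_derive t 1 (fun s => F s *m y s) (D *m y t + F t *m v).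
Proof.
move=> /is_derive_mxP FD /is_derive_mxP yv; apply/is_derive_mxP => i j.
rewrite (_ : (fun s => _) = \sum_(k < 2) (fun s => F s i k * y s k j)); last first.
  by apply/funext => s; rewrite mxE fct_sumE.
rewrite (_ : (D *m y t + F t *m v) i j =
    \sum_(k < 2) (F t i k * v k j + y t k j * D i k)).
  apply: is_derive_sum => k; exact: is_deriveM.
rewrite !mxE -big_split /=; apply: eq_bigr => k _.
by rewrite addrC [y t k j * _]mulrC.
Qed.

Lemma is_derive_mulmxl A (y : R -> 'cV[R]_2) (t : R) v :
  is_derive t 1 y v -> is_derive t 1 (fun s => A *m y s) (A *m v).
Proof.
move=> yv; have := is_derive_mulmx (is_derive_cst A t 1) yv.
by rewrite mul0mx add0r.
Qed.

Lemma within_continuous_mx m n (S : set R) (F : R -> 'M[R]_(m, n)) i j :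
  {within S, continuous F} -> {within S, continuous (fun t => F t i j)}.
Proof.
move=> Fc.
have gc : {in [set F x | x in S], continuous (fun M : 'M[R]_(m, n) => M i j)}.
  by move=> M _; exact: coord_continuous.
exact: (within_continuous_comp _ _ _ gc Fc).
Qed.

Lemma within_continuous_mulmx (S : set R) (F : R -> 'M[R]_2)
    (y : R -> 'cV[R]_2) i :
  {within S, continuous F} ->
  (forall j, {within S, continuous (fun t => y t j 0)}) ->
  {within S, continuous (fun t => (F t *m y t) i 0)}.
Proof.
move=> Fc yc.
rewrite (_ : (fun _ => _) =
    (fun t => F t i 0) \* (fun t => y t 0 0) \+
    (fun t => F t i 1) \* (fun t => y t 1 0)); last first.
  by apply/funext => t; rewrite mulmx_col2.
move=> t; apply: continuousD; apply: continuousM;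
  (exact: within_continuous_mx || exact: yc).
Qed.

(** Uniqueness for [y' = B y]: along a solution [Phi (a - t) *m y t] has zero
    derivative. *)
Lemma linear_ode_unique B (Phi : R -> 'M[R]_2) (y : R -> 'cV[R]_2) (a b : R) :
  a <= b -> Phi 0 = 1%:M -> (forall t : R, Phi t *m Phi (- t) = 1%:M) ->
  (forall t : R, is_derive t 1 Phi (Phi t *m B)) ->
  (forall i, {within `[a, b], continuous (fun t => y t i 0)}) ->
  (forall t : R, t \in `]a, b[ -> is_derive t 1 y (B *m y t)) ->
  y b = Phi (b - a) *m y a.
Proof.
move=> ab Phi0 PhiK PhiD yc yD.
suff <- : Phi (a - b) *m y b = y a.
  by rewrite mulmxA -(opprB b a) PhiK mul1mx.
have UD (t : R) : is_derive t 1 (fun s => Phi (a - s)) (- (Phi (a - t) *m B)).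
  apply/is_derive_mxP => i j; rewrite mxE.
  have /is_derive_mxP/(_ i j) Pd := PhiD (a - t).
  have sD : is_derive t 1 (fun s => a - s) (-1 : R).
    by rewrite -[-1]add0r; exact: is_deriveB.
  have := @is_derive1_comp R (fun s => Phi s i j) (fun s => a - s) t _ _ Pd sD.
  by rewrite mulrN1.
apply/matrixP => i j; rewrite {j}ord1.
have fD (t : R) : t \in `]a, b[ ->
    is_derive t 1 (fun s => (Phi (a - s) *m y s) i 0) (0 : R).
  move=> tab; have /is_derive_mxP/(_ i 0) := is_derive_mulmx (UD t) (yD t tab).
  by rewrite mulNmx mulmxA addNr mxE.
have [|c _ /eqP] := MVT_segment ab fD.
  apply: within_continuous_mulmx => //; apply: continuous_subspaceT => t.
  by apply/differentiable_continuous/derivable1_diffP; have [] := UD t.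
by rewrite mul0r subr_eq0 => /eqP ->; rewrite subrr Phi0 mul1mx.
Qed.

End LinearFlow.

(** * The flows of the two modes in normal form *)

Section NormalFormFlows.
Variable R : realType.
Implicit Types (p q n k g h s t tau eta : R) (x : 'cV[R]_2).

Definition diag_flow p q t : 'M[R]_2 :=
  mx2 (expR (- (p * t))) 0 0 (expR (- (q * t))).

(** The exponential of [s * (n + K)] where [K = mx2 k g (- h) (- k)] squares to
    zero as soon as [k ^ 2 = g * h]. *)
Definition jordan_flow n k g h s : 'M[R]_2 :=
  expR (n * s) *: mx2 (1 + s * k) (s * g) (- (s * h)) (1 - s * k).

Lemma diag_flow0 p q : diag_flow p q 0 = 1%:M.
Proof. by rewrite /diag_flow !mulr0 oppr0 expR0 mx2_1. Qed.

Lemma diag_flowD p q s t :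
  diag_flow p q (s + t) = diag_flow p q s *m diag_flow p q t.
Proof.
by rewrite mx2M /diag_flow !mulrDr !opprD !expRD !(mulr0, mul0r, addr0, add0r).
Qed.

Lemma diag_flowK p q t : diag_flow p q t *m diag_flow p q (- t) = 1%:M.
Proof. by rewrite -diag_flowD subrr diag_flow0. Qed.

Lemma is_derive_expRM (a t : R) :
  is_derive t 1 (fun s => expR (a * s)) (expR (a * t) * a).
Proof.
have aD : is_derive t 1 (fun s => a * s) a.
  by apply: is_derive_eq; rewrite /GRing.scale /= mulr1.
exact: (is_derive1_comp (is_derive_expR _) aD).
Qed.

Lemma is_derive_diag_flow p q t :
  is_derive t 1 (diag_flow p q) (diag_flow p q t *m mx2 (- p) 0 0 (- q)).
Proof.
rewrite mx2M; apply/is_derive_mxP => i j; rewrite mxE.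
rewrite (_ : (fun s => _) = fun s =>
    if i == 0 then (if j == 0 then expR (- p * s) else 0)
    else (if j == 0 then 0 else expR (- q * s))); last first.
  by apply/funext => s; rewrite mxE !mulNr.
rewrite !(mulr0, mul0r, addr0, add0r) -!mulNr.
by case: (i == 0); case: (j == 0);
  [exact: is_derive_expRM|exact: is_derive_cst|exact: is_derive_cst|
   exact: is_derive_expRM].
Qed.

Lemma enorm_diag_flow p q t x : 0 <= p -> p <= q -> 0 <= t ->
  enorm (diag_flow p q t *m x) <= expR (- (p * t)) * enorm x.
Proof.
move=> p0 pq t0; apply: enorm_le; first exact: expR_ge0.
rewrite !mulmx_mx2 !mul0r addr0 add0r !exprMn mulrDr lerD2l.
rewrite ler_wpM2r ?sqr_ge0// ler_sqr ?nnegrE ?expR_ge0// ler_expR lerN2.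
by rewrite ler_wpM2r.
Qed.

Lemma enorm_diag_flow_le p q t x : 0 <= p -> p <= q -> 0 <= t ->
  enorm (diag_flow p q t *m x) <= enorm x.
Proof.
move=> p0 pq t0; apply: le_trans (enorm_diag_flow _ p0 pq t0) _.
rewrite -[leRHS]mul1r ler_wpM2r ?enorm_ge0// -(expR0 R) ler_expR.
by rewrite oppr_le0 mulr_ge0.
Qed.

Lemma jordan_flow0 n k g h : jordan_flow n k g h 0 = 1%:M.
Proof.
by rewrite /jordan_flow mulr0 expR0 scale1r !mul0r oppr0 addr0 mx2_1.
Qed.

Lemma jordan_flowK n k g h s : k ^+ 2 = g * h ->
  jordan_flow n k g h s *m jordan_flow n k g h (- s) = 1%:M.
Proof.
move=> kgh; rewrite /jordan_flow -scalemxAl -scalemxAr scalerA -expRD.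
rewrite mulrN subrr expR0 scale1r mx2M -mx2_1.
congr (mx2 _ _ _ _); ring: kgh.
Qed.

Lemma is_derive_jordan_flow n k g h s : k ^+ 2 = g * h ->
  is_derive s 1 (jordan_flow n k g h)
    (jordan_flow n k g h s *m mx2 (n + k) g (- h) (n - k)).
Proof.
move=> kgh; rewrite -scalemxAl mx2M; apply/is_derive_mxP => i j.
have eD (a b : R) : is_derive s 1 (fun t => expR (n * t) * (a + t * b))
    (expR (n * s) * (n * (a + s * b) + b)).
  have lD : is_derive s 1 (fun t => a + t * b) b.
    by apply: is_derive_eq; rewrite /GRing.scale /=; ring.
  apply: is_derive_eq (is_deriveM (is_derive_expRM n s) lD) _.
  by rewrite /GRing.scale /=; ring.
rewrite !mxE (_ : (fun t => _) = fun t => expR (n * t) *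
    ((if i == 0 then (if j == 0 then 1 else 0) else (if j == 0 then 0 else 1))
     + t * (if i == 0 then (if j == 0 then k else g)
            else (if j == 0 then - h else - k)))); last first.
  apply/funext => t; rewrite !mxE; congr (_ * _).
  by case: (i == 0); case: (j == 0); ring.
apply: is_derive_eq; congr (_ * _).
by case: (i == 0); case: (j == 0); ring: kgh.
Qed.

Lemma jordan_flow_bounded n k g h eta : 0 <= n ->
  exists2 C : R, 0 < C & forall s x, 0 <= s <= eta ->
    enorm (jordan_flow n k g h s *m x) <= C * enorm x.
Proof.
move=> n0; pose m := expR (n * eta) * (1 + eta * (`|k| + `|g| + `|h|)).
exists (2 * `|m| + 1); first by rewrite ltr_wpDl// mulr_ge0.
move=> s x /andP[s0 se]; apply: le_trans (enorm_mulmx_le _ _) _.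
rewrite ler_wpM2r ?enorm_ge0// (@le_trans _ _ (2 * `|m|))// ?lerDl//.
have m0 : 0 <= m.
  by rewrite mulr_ge0 ?expR_ge0// addr_ge0// mulr_ge0 ?addr_ge0// (le_trans s0).
have entry_le i j : jordan_flow n k g h s i j ^+ 2 <= m ^+ 2.
  have entryP (u v : R) : `|u| <= 1 -> `|v| <= `|k| + `|g| + `|h| ->
      (expR (n * s) * (u + s * v)) ^+ 2 <= m ^+ 2.
    move=> u1 vK; rewrite -(real_normK (num_real (_ * _))).
    rewrite ler_sqr ?nnegrE// normrM (ger0_norm (expR_ge0 _)).
    rewrite ler_pM ?expR_ge0// ?ler_expR ?ler_wpM2l//.
    rewrite (le_trans (ler_normD _ _))// lerD// normrM (ger0_norm s0).
    by rewrite ler_pM.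
  have k0 := normr_ge0 k; have g0 := normr_ge0 g; have h0 := normr_ge0 h.
  rewrite !mxE; case: (i == 0); case: (j == 0).
  - by apply: entryP; rewrite ?normr1//; lra.
  - by rewrite -[s * g]add0r; apply: entryP; rewrite ?normr0 ?ler01//; lra.
  - rewrite -mulrN -[s * - h]add0r; apply: entryP; rewrite ?normr0 ?ler01//.
    by rewrite normrN; lra.
  - by rewrite -mulrN; apply: entryP; rewrite ?normr1 ?normrN//; lra.
have m2 : 0 <= 2 * m by exact: mulr_ge0.
rewrite (ger0_norm m0) -[leRHS](ger0_norm m2).
rewrite -sqrtr_sqr ler_wsqrtr//.
by rewrite exprMn; have := entry_le 0 0; have := entry_le 0 1;
  have := entry_le 1 0; have := entry_le 1 1; lra.
Qed.

End NormalFormFlows.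

(** * Trajectories over dwell intervals and cycles *)

Section DwellIntervals.
Variable R : realType.

Lemma switch_time_le (s : signal R) i j :
  (i <= j)%N -> switch_time s i <= switch_time s j.
Proof.
move: i j; apply/nondecreasing_seqP => k.
exact/ltW/switch_time_incr.
Qed.

Lemma switch_time_ge0 (s : signal R) i : 0 <= switch_time s i.
Proof. by rewrite -(switch_time0 s) switch_time_le. Qed.

Lemma sig_alternates (s : signal R) k : s 0 = mode1 ->
  s (switch_time s (2 * k)) = mode1 /\ s (switch_time s (2 * k).+1) = mode2.
Proof.
move=> s0; elim: k => [|k [_ IH]]; last first.
  have := @sig_switch _ s (2 * k).+1; have := @sig_switch _ s (2 * k).+2.
  rewrite (_ : (2 * k.+1)%N = (2 * k).+2) ?mulnS// IH.
  by case: (s _); case: (s _) => //.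
have := @sig_switch _ s 0; rewrite muln0 switch_time0 s0.
by case: (s _).
Qed.

Lemma cycle_of_time (s : signal R) t : 0 <= t ->
  exists k, switch_time s (2 * k) <= t < switch_time s (2 * k.+1).
Proof.
move=> t0; have /cvgryPge/(_ (t + 1)) [N _ /(_ N (leqnn N)) /= tN] :=
  @switch_time_cvg _ s.
have exN : exists N, t < switch_time s N by exists N; lra.
case: (ex_minnP exN) => -[|m] tm mmin.
  by move: tm; rewrite switch_time0 ltNge t0.
exists m./2; apply/andP; split.
  have mt : switch_time s m <= t.
    by rewrite leNgt; apply/negP => /mmin; rewrite ltnn.
  apply: le_trans mt; apply: switch_time_le.
  by rewrite mul2n -[leqRHS](odd_double_half m) leq_addl.
apply: lt_le_trans tm _; apply: switch_time_le.
rewrite mul2n doubleS -[m in leqLHS](odd_double_half m) ltnS.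
by case: (odd m).
Qed.

(** The coordinates [Q] are a parameter so that both modes can be followed in
    the coordinates in which their matrices have a common normal form. *)
Lemma trajectory_dwell (A1 A2 Q B : 'M[R]_2) (Phi : R -> 'M[R]_2)
    (s : signal R) x j t :
  Phi 0 = 1%:M -> (forall t : R, Phi t *m Phi (- t) = 1%:M) ->
  (forall t : R, is_derive t 1 Phi (Phi t *m B)) ->
  Q *m mode_mx A1 A2 (s (switch_time s j)) = B *m Q ->
  trajectory A1 A2 s x -> switch_time s j <= t <= switch_time s j.+1 ->
  Q *m x t = Phi (t - switch_time s j) *m (Q *m x (switch_time s j)).
Proof.
move=> Phi0 PhiK PhiD QB [xc xD] /andP[jt tj].
apply: (linear_ode_unique (y := fun t => Q *m x t) jt Phi0 PhiK PhiD).
  have {}xc : {within `[switch_time s j, t], continuous x}.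
    apply: continuous_subspaceW xc => u /=; rewrite !in_itv /= andbT.
    by move=> /andP[+ _]; apply: le_trans; exact: switch_time_ge0.
  move=> i; apply: (within_continuous_mulmx (F := cst Q)).
    by apply: continuous_subspaceT => u; exact: cvg_cst.
  by move=> i'; exact: within_continuous_mx.
move=> u; rewrite in_itv /= => /andP[ju ut].
rewrite mulmxA -QB -mulmxA; apply: is_derive_mulmxl.
rewrite -(@sig_const _ s j u) ?(ltW ju) ?(lt_le_trans ut tj)//.
apply: xD => [|k uk]; first exact: le_lt_trans (switch_time_ge0 s j) ju.
have [kj|jk] := leqP k j.
  by have := switch_time_le s kj; rewrite -uk leNgt ju.
by have := switch_time_le s jk; rewrite -uk leNgt (lt_le_trans ut tj).
Qed.

(** The limit [l] exists by monotonicity; were it positive, a step with factor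
    [rho] taken from close enough to [l] would lead below [l]. *)
Lemma cvg0_contract_often (u : nat -> R) (rho : R) :
  (forall k, 0 <= u k) -> (forall k, u k.+1 <= u k) -> rho < 1 -> 0 <= rho ->
  (forall K, exists2 k, (K <= k)%N & u k.+1 <= rho * u k) ->
  u k @[k --> \oo] --> 0.
Proof.
move=> u0 udec rho1 rho0 often.
have uni : nonincreasing_seq u by apply/nonincreasing_seqP.
have ulb : has_lbound (range u) by exists 0 => _ [k _ <-].
have ucv := nonincreasing_cvgn uni ulb.
set l := inf _ in ucv.
have lu k : l <= u k by apply: ge_inf => //; exists k.
have l0 : 0 <= l by apply: lb_le_inf; [exists (u 0%N); exists 0%N|move=> _ [k _ <-]].
have [l00|l_neq0] := eqVneq l 0; first by move: ucv; rewrite l00.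
have {l_neq0}l0 : 0 < l by rewrite lt_neqAle eq_sym l_neq0.
have /cvgrPdist_lt/(_ ((1 - rho) * l)) := ucv.
rewrite mulr_gt0 ?subr_gt0// => /(_ isT) [K _ Kl].
have [k Kk uk] := often K.
have /= := Kl k Kk; rewrite distrC ger0_norm ?subr_ge0// => ukl.
have := lu k.+1; have : rho * u k <= rho * (l + (1 - rho) * l).
  by rewrite ler_wpM2l//; lra.
have : 0 < (1 - rho) ^+ 2 * l by rewrite mulr_gt0 ?exprn_gt0 ?subr_gt0.
nra.
Qed.

End DwellIntervals.

(** * From a contracting cycle to stability *)

Section Contraction.
Variable R : realType.
Variables (A1 A2 Q : 'M[R]_2) (p q n k g h tau eta : R).
Hypotheses (p0 : 0 < p) (pq : p <= q) (n0 : 0 <= n).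
Hypothesis kgh : k ^+ 2 = g * h.
Hypothesis Qunit : Q \in unitmx.
Hypothesis QA1 : Q *m A1 = mx2 (- p) 0 0 (- q) *m Q.
Hypothesis QA2 : Q *m A2 = mx2 (n + k) g (- h) (n - k) *m Q.

Let F1 := diag_flow p q.
Let F2 := jordan_flow n k g h.

(** A cycle that spends [tau] in mode 1 and [r] in mode 2, with the time in
    mode 1 split in two halves: when [g = h] this makes [G r] symmetric up to a
    reflection, so that its Euclidean operator norm is governed by its
    diagonal entries. *)
Let G r := F1 (tau / 2) *m F2 r *m F1 (tau / 2).

(** Letting half of the minimal time in mode 1 pass before measuring is what
    makes [G] the matrix that compares consecutive cycles. *)
Let energy x := enorm (F1 (tau / 2) *m (Q *m x)).

Section OneSignal.
Variable s : signal R.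
Hypothesis sP : dwell_class tau eta s.
Variable x : R -> 'cV[R]_2.
Hypothesis xP : trajectory A1 A2 s x.

Let d := switch_time s.

Lemma mode1_flow i t : d (2 * i) <= t <= d (2 * i).+1 ->
  Q *m x t = F1 (t - d (2 * i)) *m (Q *m x (d (2 * i))).
Proof.
move=> tP; apply: (trajectory_dwell _ _ _ _ xP tP).
- exact: diag_flow0.
- exact: diag_flowK.
- exact: is_derive_diag_flow.
- by rewrite (sig_alternates i sP.1).1.
Qed.

Lemma mode2_flow i t : d (2 * i).+1 <= t <= d (2 * i).+2 ->
  Q *m x t = F2 (t - d (2 * i).+1) *m (Q *m x (d (2 * i).+1)).
Proof.
move=> tP; apply: (trajectory_dwell _ _ _ _ xP tP).
- exact: jordan_flow0.
- by move=> r; exact: jordan_flowK.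
- by move=> r; exact: is_derive_jordan_flow.
- by rewrite (sig_alternates i sP.1).2.
Qed.

Lemma dwell1_ge i : tau <= dwell1 s i.
Proof. by have [] := sP.2 i. Qed.

Lemma dwell2_itv i : 0 <= dwell2 s i <= eta.
Proof.
have [_ ->] := sP.2 i; rewrite andbT subr_ge0; exact/ltW/switch_time_incr.
Qed.

(** As [F1] commutes with itself, conjugation by [F1 (tau / 2)] turns the cycle
    [F2 (dwell2 s i) *m F1 (dwell1 s i)] into [G (dwell2 s i)] preceded by the
    contraction [F1 (dwell1 s i - tau)]. *)
Lemma cycle_flow i :
  F1 (tau / 2) *m (Q *m x (d (2 * i.+1))) =
  G (dwell2 s i) *m (F1 (dwell1 s i - tau) *m
    (F1 (tau / 2) *m (Q *m x (d (2 * i))))).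
Proof.
have dle j : d j <= d j.+1 by exact/ltW/switch_time_incr.
rewrite (_ : (2 * i.+1)%N = (2 * i).+2) ?mulnS//.
rewrite (@mode2_flow i (d (2 * i).+2)) ?dle ?lexx//.
rewrite (@mode1_flow i (d (2 * i).+1)) ?dle ?lexx//.
rewrite -/(dwell1 s i) -/(dwell2 s i).
have -> : F1 (dwell1 s i) =
    F1 (tau / 2) *m F1 (dwell1 s i - tau) *m F1 (tau / 2).
  by rewrite /F1 -!diag_flowD; congr diag_flow; field.
by rewrite /G !mulmxA.
Qed.

Lemma energy_cycle (rho delta : R) i : 0 <= rho -> delta <= dwell1 s i - tau ->
  (forall z, enorm (G (dwell2 s i) *m z) <= rho * enorm z) ->
  energy (x (d (2 * i.+1))) <=
    rho * expR (- (p * delta)) * energy (x (d (2 * i))).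
Proof.
move=> rho0 dl Gle; rewrite /energy cycle_flow; apply: le_trans (Gle _) _.
rewrite -mulrA ler_wpM2l//.
apply: le_trans (enorm_diag_flow _ (ltW p0) pq _) _.
  by rewrite subr_ge0 dwell1_ge.
by rewrite ler_wpM2r ?enorm_ge0// ler_expR lerN2 ler_wpM2l// ltW.
Qed.

End OneSignal.

Lemma energy_bounds :
  exists2 C : R, 0 < C & (forall v, energy v <= C * enorm v) /\
    forall s x, dwell_class tau eta s -> trajectory A1 A2 s x ->
    forall i t, switch_time s (2 * i) <= t <= switch_time s (2 * i.+1) ->
      enorm (x t) <= C * energy (x (switch_time s (2 * i))).
Proof.
have [C1 C1p C1P] := enorm_mulmx_bounded (F1 (tau / 2) *m Q).
have [C2 C2p C2P] := enorm_mulmx_bounded (invmx Q).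
have [C3 C3p C3P] := enorm_mulmx_bounded (F1 (- (tau / 2))).
have [C4 C4p C4P] := jordan_flow_bounded k g h eta n0.
exists (C1 + C2 * ((1 + C4) * C3)).
  by rewrite addr_gt0// !mulr_gt0// addr_gt0.
split=> [v|s x sP xP i t].
  rewrite /energy mulmxA; apply: le_trans (C1P v) _.
  rewrite ler_wpM2r ?enorm_ge0// lerDl !mulr_ge0 ?addr_ge0// ltW//.
set d := switch_time s => /andP[dt td].
have E0 : 0 <= energy (x (d (2 * i))%N) by exact: enorm_ge0.
apply: (@le_trans _ _ (C2 * ((1 + C4) * C3) * energy (x (d (2 * i)%N)))); last first.
  by rewrite ler_wpM2r// lerDr ltW.
rewrite -[x t](mulKmx Qunit); apply: le_trans (C2P _) _.
rewrite -!mulrA; apply: ler_wpM2l; first exact: ltW.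
have start : enorm (Q *m x (d (2 * i)%N)) <= C3 * energy (x (d (2 * i)%N)).
  apply: le_trans (C3P _); rewrite mulmxA /F1 -diag_flowD.
  by rewrite addNr diag_flow0 mul1mx.
have mid u : d (2 * i)%N <= u <= d (2 * i).+1 ->
    enorm (Q *m x u) <= C3 * energy (x (d (2 * i)%N)).
  move=> uP; rewrite (mode1_flow sP xP uP); apply: le_trans start.
  apply: enorm_diag_flow_le; rewrite ?(ltW p0)// subr_ge0.
  by case/andP: uP.
have C3E : 0 <= C3 * energy (x (d (2 * i)%N)) by rewrite mulr_ge0// ltW.
have [tm|mt] := leP t (d (2 * i).+1).
  apply: le_trans (mid t _) _; first by rewrite dt.
  by rewrite mulrDl mul1r lerDl mulr_ge0// ltW.
have tP : d (2 * i).+1 <= t <= d (2 * i).+2.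
  by rewrite (ltW mt) (le_trans td)// mulnS.
rewrite (mode2_flow sP xP tP).
apply: le_trans (C4P _ _ _) _.
  rewrite subr_ge0 (ltW mt) /=; have /andP[_] := dwell2_itv sP i.
  by apply: le_trans; rewrite lerB//; case/andP: tP.
apply: (@le_trans _ _ (C4 * (C3 * energy (x (d (2 * i)%N))))).
  apply: ler_wpM2l; [exact: ltW|apply: mid; rewrite lexx andbT].
  exact/ltW/switch_time_incr.
by rewrite mulrDl mul1r lerDr.
Qed.

Hypothesis G_le : forall r z, 0 <= r <= eta -> enorm (G r *m z) <= enorm z.

Lemma energy_noninc s x i : dwell_class tau eta s -> trajectory A1 A2 s x ->
  energy (x (switch_time s (2 * i.+1))) <= energy (x (switch_time s (2 * i))).
Proof.
move=> sP xP.
have := @energy_cycle s sP x xP 1 0 i ler01.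
rewrite mulr0 oppr0 expR0 !mul1r subr_ge0 dwell1_ge//; apply=> // z.
by rewrite mul1r G_le// dwell2_itv.
Qed.

Lemma stable_of_cycle_le s : dwell_class tau eta s -> stable A1 A2 s.
Proof.
move=> sP eps eps0; have [C C0 [EC CE]] := energy_bounds.
exists (eps / (C * C)) => [|x xP x0 t t0]; first by rewrite divr_gt0 ?mulr_gt0.
have [i /andP[it ti]] := cycle_of_time s (ltW t0).
apply: le_lt_trans (CE _ _ sP xP i t _) _; first by rewrite it ltW.
have Ei : energy (x (switch_time s (2 * i))) <= energy (x 0).
  elim: i {it ti} => [|i IH]; first by rewrite muln0 switch_time0.
  exact: le_trans (energy_noninc i sP xP) IH.
apply: (@le_lt_trans _ _ (C * (C * enorm (x 0)))).
  by apply: ler_wpM2l; [exact: ltW|exact: le_trans Ei _].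
by rewrite mulrA mulrC -ltr_pdivlMr ?mulr_gt0.
Qed.

Hypothesis G_lt : forall delta, 0 < delta -> exists2 rho : R, 0 <= rho < 1 &
  forall r z, 0 <= r <= eta - delta -> enorm (G r *m z) <= rho * enorm z.

(** If the dwell times do not converge to [(tau, eta)], infinitely many cycles
    exceed [tau] or fall short of [eta] by a fixed amount, and each of them
    contracts the energy by a fixed factor. *)
Lemma energy_contracts_often s : dwell_class' tau eta s ->
  exists2 rho : R, 0 <= rho < 1 &
  forall x, trajectory A1 A2 s x -> forall K, exists2 i, (K <= i)%N &
    energy (x (switch_time s (2 * i.+1))) <=
    rho * energy (x (switch_time s (2 * i))).
Proof.
move=> [sP ncv].
have often (T : nat -> R) l : ~ (T i @[i --> \oo] --> l) ->
    exists2 delta : R, 0 < delta &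
      forall K, exists2 i, (K <= i)%N & delta <= `|l - T i|.
  move=> nT; apply: contrapT => nd; apply: nT; apply/cvgrPdist_lt => e e0.
  apply: contrapT => ne; case: nd; exists e => // K.
  apply: contrapT => nK; case: ne; exists K => // i /= Ki.
  by rewrite ltNge; apply/negP => ei; case: nK; exists i.
have [cv1|/often[delta dp dP]] := pselect (dwell1 s i @[i --> \oo] --> tau).
  have /often[delta dp dP] : ~ (dwell2 s i @[i --> \oo] --> eta).
    by move=> cv2; exact: (ncv (cvg_pair cv1 cv2)).
  have [rho rhoP rhoG] := G_lt dp.
  exists rho => // x xP K; have [i Ki di] := dP K; exists i => //.
  have /andP[rho0 _] := rhoP; have /andP[s0 se] := dwell2_itv sP i.
  have := @energy_cycle s sP x xP rho 0 i rho0.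
  rewrite mulr0 oppr0 expR0 mulr1; apply; first by rewrite subr_ge0 dwell1_ge.
  move=> z; apply: rhoG; rewrite s0/=.
  by move: di; rewrite ger0_norm ?subr_ge0//; lra.
exists (expR (- (p * delta))) => [|x xP K].
  by rewrite expR_ge0 -(expR0 R) ltr_expR oppr_lt0 mulr_gt0.
have [i Ki di] := dP K; exists i => //.
have := @energy_cycle s sP x xP 1 delta i ler01; rewrite mul1r; apply.
  by move: di; rewrite distrC ger0_norm// subr_ge0 dwell1_ge.
by move=> z; rewrite mul1r G_le// dwell2_itv.
Qed.

Lemma asymptotically_stable_of_cycle_lt s :
  dwell_class' tau eta s -> asymptotically_stable A1 A2 s.
Proof.
move=> sP'; have [sP _] := sP'; split; first exact: stable_of_cycle_le.
move=> x xP; have [rho /andP[rho0 rho1] rhoP] := energy_contracts_often sP'.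
have [C C0 [_ CE]] := energy_bounds.
have /cvgrPdist_lt E0 := @cvg0_contract_often R
  (fun i => energy (x (switch_time s (2 * i)))) rho (fun i => enorm_ge0 _)
  (fun i => energy_noninc i sP xP) rho1 rho0 (rhoP x xP).
apply/cvgrPdist_lt => e e0.
have [|K _ KE] := E0 (e / C); first exact: divr_gt0.
exists (switch_time s (2 * K)); split; first exact: num_real.
move=> t Kt; have t0 : 0 <= t by rewrite (le_trans (switch_time_ge0 s _) (ltW Kt)).
have [i /andP[it ti]] := cycle_of_time s t0.
have Ki : (K <= i)%N.
  rewrite leqNgt; apply/negP => iK.
  have := lt_trans Kt ti; rewrite ltNge switch_time_le//.
  by rewrite leq_mul2l.
have := KE i Ki; rewrite !sub0r !normrN !ger0_norm ?enorm_ge0// => Ei.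
apply: le_lt_trans (CE _ _ sP xP i t _) _; first by rewrite it ltW.
by rewrite mulrC -ltr_pdivlMr.
Qed.

End Contraction.

(** * The threshold equations *)

Section Threshold.
Variable R : realType.

(** This expresses that [(sinh y + e * sinh x) / cosh x] increases when [y]
    grows faster than [x]. For [v = u] the addition formulas give
    [sinh u * (cosh (y - x) + e)] as difference of the two sides; a larger [v]
    makes the inequality strict. *)
Lemma sinh_cosh_ratio_lt (e x y u v : R) : -1 <= e -> 0 <= u -> u < v ->
  (sinh y + e * sinh x) * cosh (x + u) <
  (sinh (y + v) + e * sinh (x + u)) * cosh x.
Proof.
move=> e1 u0 uv.
have : sinh (y + u) * cosh x < sinh (y + v) * cosh x.
  by rewrite ltr_pM2r ?cosh_gt0// ltr_sinh ltrD2l.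
have : 0 <= sinh u * (cosh (y - x) + e).
  by rewrite mulr_ge0 ?sinh_ge0//; have := cosh_ge1 (y - x); lra.
have xE := cosh2B_sinh2 x.
rewrite !sinhD !coshD coshN sinhN.
have : sinh u * e = sinh u * e * (cosh x ^+ 2 - sinh x ^+ 2).
  by rewrite xE mulr1.
lra.
Qed.

Variables p q c L e : R.
Hypotheses (p0 : 0 < p) (pq : p <= q) (c0 : 0 <= c) (L0 : 0 < L).
Hypothesis e1 : -1 <= e.

Let x t := (q - p) / 2 * t.
Let y t := (q + p) / 2 * t - c.
Let F t := sinh (y t) + e * sinh (x t).

Lemma threshold_lt t t' : t < t' -> F t * cosh (x t') < F t' * cosh (x t).
Proof.
move=> tt'; rewrite /F.
have -> : x t' = x t + (q - p) / 2 * (t' - t) by rewrite /x; ring.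
have -> : y t' = y t + (q + p) / 2 * (t' - t) by rewrite /y; ring.
apply: sinh_cosh_ratio_lt => //; first by rewrite mulr_ge0 ?divr_ge0 ?subr_ge0// ltW.
by rewrite ltr_pM2r ?subr_gt0//; have := p0; lra.
Qed.

Lemma threshold_le t t' : t <= t' ->
  L * cosh (x t) = F t -> L * cosh (x t') <= F t'.
Proof.
rewrite le_eqVlt => /predU1P[-> ->//|/threshold_lt + LF].
rewrite -LF mulrAC ltr_pM2r ?cosh_gt0//; exact: ltW.
Qed.

(** Uniqueness holds because [F / cosh x] is strictly increasing, existence by
    the intermediate value theorem. *)
Lemma threshold_exists_unique : exists! t, 0 < t /\ L * cosh (x t) = F t.
Proof.
(* [T] solves [y T - x T = L], so that convexity of [sinh] on the positive
   half-line yields [L * cosh (x T) <= F T]. *)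
pose T := (L + c) / p.
have T0 : 0 < T by rewrite divr_gt0// ltr_pwDl.
have xT : 0 <= x T.
  by apply: mulr_ge0; [rewrite divr_ge0 ?subr_ge0|exact: ltW].
have yT : y T - x T = L.
  by rewrite /y /x /T; field; rewrite gt_eqF.
have xyT : x T <= y T by have := L0; lra.
pose H t := F t - L * cosh (x t).
have xc : continuous x by move=> t; exact: mulrl_continuous.
have yc : continuous y.
  by move=> t; apply: cvgB; [exact: mulrl_continuous|exact: cvg_cst].
have Hc : continuous H.
  move=> t; apply: cvgB.
    apply: cvgD; first exact: (continuous_comp (yc t) (@continuous_sinh _ _)).
    by apply: cvgMr; exact: (continuous_comp (xc t) (@continuous_sinh _ _)).
  by apply: cvgMr; exact: (continuous_comp (xc t) (@continuous_cosh _ _)).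
have H0 : H 0 < 0.
  rewrite /H /F /x /y !mulr0 sub0r sinhN sinh0 mulr0 addr0.
  have := sinh_ge0 c0; have := cosh_ge1 (0 : R); have := L0; nra.
have HT : 0 <= H T.
  have := sinhB_ge xT xyT; rewrite yT /H /F; have := sinh_ge0 xT; have := e1; nra.
have [|t /itvP tP Ht] := @IVT R H 0 T 0 (ltW T0) (continuous_subspaceT Hc).
  by rewrite ge_min (ltW H0) le_max HT orbT.
have t0 : 0 < t.
  rewrite lt_neqAle tP andbT; apply/eqP => t0.
  by have := H0; rewrite (congr1 H t0) Ht ltxx.
have tE : L * cosh (x t) = F t by apply/esym/eqP; rewrite -subr_eq0 -/(H t) Ht.
exists t; split=> [//|t' [t'0 t'E]].
apply/eqP; rewrite eq_le !leNgt; apply/andP; split; apply/negP => /threshold_lt.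
  by rewrite -tE -t'E mulrAC ltxx.
by rewrite -tE -t'E mulrAC ltxx.
Qed.

End Threshold.

(** * The norm of a cycle *)

Section CycleNorm.
Variable R : realType.

Definition stabilizes (A1 A2 : 'M[R]_2) (eta tau : R) :=
  (forall s : signal R, dwell_class tau eta s -> stable A1 A2 s) /\
  (forall s : signal R, dwell_class' tau eta s ->
     asymptotically_stable A1 A2 s).

Lemma half_cycleE (p q n k g h tau r : R) :
  diag_flow p q (tau / 2) *m jordan_flow n k g h r *m diag_flow p q (tau / 2) =
  expR (n * r - (q + p) / 2 * tau) *:
    mx2 (expR ((q - p) / 2 * tau) * (1 + r * k)) (r * g)
        (- (r * h)) (expR (- ((q - p) / 2 * tau)) * (1 - r * k)).
Proof.
rewrite /jordan_flow -scalemxAr -scalemxAl !mx2M.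
rewrite !(mulr0, mul0r, addr0, add0r) expRD -scalerA; congr (_ *: _).
have pp : expR (- (p * (tau / 2))) * expR (- (p * (tau / 2))) =
    expR (- ((q + p) / 2 * tau)) * expR ((q - p) / 2 * tau).
  by rewrite -!expRD; congr expR; field.
have qq : expR (- (q * (tau / 2))) * expR (- (q * (tau / 2))) =
    expR (- ((q + p) / 2 * tau)) * expR (- ((q - p) / 2 * tau)).
  by rewrite -!expRD; congr expR; field.
have pq : expR (- (p * (tau / 2))) * expR (- (q * (tau / 2))) =
    expR (- ((q + p) / 2 * tau)).
  by rewrite -!expRD; congr expR; field.
apply/matrixP => i j; rewrite !mxE; case: (i == 0); case: (j == 0).
- by ring: pp.
- by ring: pq.
- by ring: pq.
- by ring: qq.
Qed.

End CycleNorm.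

Section NormalForm.
Variable R : realType.

(** Rescaling the eigenvectors of [A1] by [u] and [v] changes the off-diagonal
    entries of the nilpotent part of [A2] but not their product. *)
Lemma normal_form (A1 A2 P1 P2 : 'M[R]_2) (p q n a b c d u v : R) :
  P1 \in unitmx -> P2 \in unitmx ->
  A1 = P1 *m mx2 (- p) 0 0 (- q) *m invmx P1 ->
  A2 = P2 *m mx2 n 1 0 n *m invmx P2 ->
  invmx P2 *m P1 = mx2 a b c d -> \det (mx2 a b c d) = 1 ->
  u != 0 -> v != 0 ->
  exists Q : 'M[R]_2, [/\ Q \in unitmx,
    Q *m A1 = mx2 (- p) 0 0 (- q) *m Q &
    Q *m A2 =
    mx2 (n + c * d) (d ^+ 2 * u / v) (- (c ^+ 2 * v / u)) (n - c * d) *m Q].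
Proof.
move=> P1u P2u -> -> hM hdet u0 v0.
have {}hdet : a * d - b * c = 1.
  by rewrite -hdet det_mx2.
pose S := mx2 u 0 0 v.
have Su : S \in unitmx.
  by rewrite unitmxE det_mx2 mulr0 subr0 unitfE mulf_neq0.
exists (S *m invmx P1); split; first by rewrite unitmx_mul Su unitmx_inv.
  rewrite !mulmxA mulmxKV// !mx2M.
  by congr (mx2 _ _ _ _ *m _); ring.
have -> : invmx P1 = mx2 d (- b) (- c) a *m invmx P2.
  have -> : invmx P2 = mx2 a b c d *m invmx P1 by rewrite -hM mulmxK.
  rewrite mulmxA mx2M -[LHS]mul1mx -mx2_1; congr (mx2 _ _ _ _ *m _);
    rewrite ?[LHS](esym hdet); ring.
rewrite !mulmxA mulmxKV// !mx2M.
by congr (mx2 _ _ _ _ *m _); rewrite ?[1](esym hdet); field; rewrite ?u0 ?v0.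
Qed.

Variables (A1 A2 Q : 'M[R]_2) (p q n k g h eta : R).
Hypotheses (p0 : 0 < p) (pq : p <= q) (n0 : 0 <= n) (eta0 : 0 < eta).
Hypothesis kgh : k ^+ 2 = g * h.
Hypothesis Qunit : Q \in unitmx.
Hypothesis QA1 : Q *m A1 = mx2 (- p) 0 0 (- q) *m Q.
Hypothesis QA2 : Q *m A2 = mx2 (n + k) g (- h) (n - k) *m Q.

(** When [k = 0] the cycle is triangular, with diagonal entries at most
    [expR (- (p * eps))]; the off-diagonal entry only has to be small. *)
Lemma stabilizes_triangular (eps : R) : 0 < eps -> k = 0 ->
  `|g| <= (1 - expR (- (p * eps))) / (2 * eta) ->
  `|h| <= (1 - expR (- (p * eps))) / (2 * eta) ->
  stabilizes A1 A2 eta (n / p * eta + eps).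
Proof.
move=> eps0 k0; set m := expR _ => gm hm; set tau := _ + eps.
have m0 : 0 < m by exact: expR_gt0.
have m1 : m < 1 by rewrite /m -(expR0 R) ltr_expR oppr_lt0 mulr_gt0.
have ptau : p * tau = n * eta + p * eps.
  by rewrite /tau; field; rewrite gt_eqF.
have tau0 : 0 <= tau.
  by rewrite addr_ge0 ?(ltW eps0)// !mulr_ge0 ?invr_ge0 ?(ltW p0) ?(ltW eta0).
set al := (q - p) / 2 * tau.
have al0 : 0 <= al by rewrite mulr_ge0// divr_ge0// subr_ge0.
set be := (q + p) / 2 * tau.
have beE : be - al = p * tau by rewrite /be /al; field.
have cycle_le r (z : 'cV[R]_2) : 0 <= r <= eta ->
    enorm (diag_flow p q (tau / 2) *m jordan_flow n k g h r *m
      diag_flow p q (tau / 2) *m z) <= (1 + m) / 2 * enorm z.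
  move=> /andP[r0 re]; rewrite half_cycleE k0 -/al -/be.
  have nr : n * r <= n * eta by rewrite ler_wpM2l.
  have expm w : w <= - (p * eps) -> `|expR w| <= m.
    by move=> wle; rewrite ger0_norm ?expR_ge0// ler_expR.
  have off w : `|w| <= (1 - m) / (2 * eta) ->
      `|expR (n * r - be) * (r * w)| <= (1 - m) / 2.
    move=> wm; rewrite normrM -[leRHS]mul1r ler_pM//.
      by apply: le_trans (ltW m1); apply: expm; lra.
    rewrite normrM (ger0_norm r0).
    rewrite [leRHS](_ : _ = eta * ((1 - m) / (2 * eta))); last first.
      by field; rewrite gt_eqF.
    by rewrite ler_pM.
  rewrite (_ : expR (n * r - be) *: _ = mx2
      (expR (n * r - be + al)) (expR (n * r - be) * (r * g))
      (expR (n * r - be) * (r * - h)) (expR (n * r - be - al))); last first.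
    apply/matrixP => i j; rewrite !mxE !expRD; case: (i == 0); case: (j == 0);
    ring.
  rewrite (_ : (1 + m) / 2 = m + (1 - m) / 2); last by field.
  apply: enorm_mx2_le; [| | exact: off|by apply: off; rewrite normrN].
    by apply: expm; lra.
  by apply: expm; lra.
have rho01 : 0 <= (1 + m) / 2 < 1.
  by apply/andP; split; lra.
have le1 r (z : 'cV[R]_2) : 0 <= r <= eta ->
    enorm (diag_flow p q (tau / 2) *m jordan_flow n k g h r *m
      diag_flow p q (tau / 2) *m z) <= enorm z.
  move=> rP; apply: le_trans (cycle_le r z rP) _.
  by rewrite -[leRHS]mul1r ler_wpM2r ?enorm_ge0//; case/andP: rho01 => _ /ltW.
split=> s sP.
  exact: (stable_of_cycle_le p0 pq n0 kgh Qunit QA1 QA2 le1 sP).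
apply: (asymptotically_stable_of_cycle_lt p0 pq n0 kgh Qunit QA1 QA2 le1) sP.
move=> delta delta0; exists ((1 + m) / 2) => // r z /andP[r0 re].
by apply: cycle_le; rewrite r0/=; lra.
Qed.

End NormalForm.

(** When [k != 0] the rescaling can be chosen with [g = h = k]. *)
Section Coupled.
Variable R : realType.
Variables (A1 A2 Q : 'M[R]_2) (p q n k eta tau : R).
Hypotheses (p0 : 0 < p) (pq : p <= q) (n0 : 0 <= n) (eta0 : 0 < eta).
Hypothesis Qunit : Q \in unitmx.
Hypothesis QA1 : Q *m A1 = mx2 (- p) 0 0 (- q) *m Q.
Hypothesis QA2 : Q *m A2 = mx2 (n + k) k (- k) (n - k) *m Q.

Let al := (q - p) / 2 * tau.
Let be r := (q + p) / 2 * tau - n * r.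
Let S r := sinh al + r * k * cosh al.

(** The bound of [enorm_reflect_le] for the cycle. As
    [|S| + sqrt (S ^ 2 + 1)] is the exponential of [arsinh |S|], the gain is at
    most 1 exactly when [|S| <= sinh be]. *)
Let gain r := expR (- be r) * (`|S r| + Num.sqrt (S r ^+ 2 + 1)).

Lemma cycle_gain r z :
  enorm (diag_flow p q (tau / 2) *m jordan_flow n k k k r *m
    diag_flow p q (tau / 2) *m z) <= gain r * enorm z.
Proof.
rewrite half_cycleE -/al -scalemxAl enormZ ?expR_ge0// /gain -[leRHS]mulrA.
rewrite /be opprB; apply: ler_wpM2l; first exact: expR_ge0.
have -> : S r = (expR al * (1 + r * k) - expR (- al) * (1 - r * k)) / 2.
  by rewrite /S /sinh /cosh; field.
apply: enorm_reflect_le.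
rewrite mulrACA -expRD subrr expR0; ring.
Qed.

Lemma sqrt_le_cosh r y : `|S r| <= sinh y ->
  Num.sqrt (S r ^+ 2 + 1) <= cosh y.
Proof.
move=> Sy; rewrite -(ger0_norm (ltW (cosh_gt0 y))) -sqrtr_sqr ler_wsqrtr//.
have : S r ^+ 2 <= sinh y ^+ 2.
  rewrite -(real_normK (num_real (S r))) ler_sqr ?nnegrE//.
  exact: le_trans Sy.
by have := cosh2B_sinh2 y; lra.
Qed.

Lemma gain_le1 r : `|S r| <= sinh (be r) -> gain r <= 1.
Proof.
move=> Sle; rewrite /gain expRN mulrC ler_pdivrMr ?expR_gt0// mul1r.
by rewrite -cosh_addsinh addrC; apply: lerD; first exact: sqrt_le_cosh.
Qed.

Lemma gain_lt1 r : `|S r| < sinh (be r) -> gain r < 1.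
Proof.
move=> Slt; rewrite /gain expRN mulrC ltr_pdivrMr ?expR_gt0// mul1r.
by rewrite -cosh_addsinh addrC; apply: ler_ltD; first exact/sqrt_le_cosh/ltW.
Qed.

Lemma gain_ge0 r : 0 <= gain r.
Proof. by rewrite mulr_ge0 ?expR_ge0// addr_ge0// sqrtr_ge0. Qed.

Lemma continuous_gain : continuous gain.
Proof.
have Sc : continuous S.
  move=> r; apply: cvgD; first exact: cvg_cst.
  by apply: cvgMl; apply: cvgMl; exact: cvg_id.
have bc : continuous be.
  by move=> r; apply: cvgB; [exact: cvg_cst|exact: mulrl_continuous].
have nbc : continuous (fun r => - be r) by move=> r; exact: cvgN (bc r).
have Rc : continuous (fun r => S r ^+ 2 + 1).
  by move=> r; apply: cvgD; [apply: cvgM; exact: Sc|exact: cvg_cst].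
move=> r; apply: cvgM.
  exact: (continuous_comp (nbc r) (@continuous_expR _ _)).
apply: cvgD; first exact: cvg_norm (Sc r).
exact: (continuous_comp (Rc r) (@sqrt_continuous _ _)).
Qed.

Lemma stabilizes_coupled :
  (forall r, 0 <= r <= eta -> `|S r| <= sinh (be r)) ->
  (forall r, 0 <= r < eta -> `|S r| < sinh (be r)) ->
  stabilizes A1 A2 eta tau.
Proof.
move=> Sle Slt.
have le1 r (z : 'cV[R]_2) : 0 <= r <= eta ->
    enorm (diag_flow p q (tau / 2) *m jordan_flow n k k k r *m
      diag_flow p q (tau / 2) *m z) <= enorm z.
  move=> rP; apply: le_trans (cycle_gain r z) _.
  by rewrite -[leRHS]mul1r ler_wpM2r ?enorm_ge0// gain_le1// Sle.
have kk : k ^+ 2 = k * k by [].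
split=> s sP.
  exact: (stable_of_cycle_le p0 pq n0 kk Qunit QA1 QA2 le1 sP).
apply: (asymptotically_stable_of_cycle_lt p0 pq n0 kk Qunit QA1 QA2 le1) sP.
move=> delta delta0; have [ed|de] := ltP eta delta.
  exists 0; first by rewrite lexx ltr01.
  by move=> r z /andP[r0 re]; exfalso; lra.
(* Compactness makes the strict bound uniform away from [eta]. *)
have ed0 : 0 <= eta - delta by rewrite subr_ge0.
have [c /itvP cP cmax] := EVT_max ed0 (continuous_subspaceT continuous_gain).
exists (gain c); first by rewrite gain_ge0 gain_lt1// Slt// cP/=;
  apply: (@le_lt_trans _ _ (eta - delta)); rewrite ?cP// ltrBlDr ltrDl.
move=> r z rP; apply: le_trans (cycle_gain r z) _.
by rewrite ler_wpM2r ?enorm_ge0// cmax// in_itv.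
Qed.

Hypothesis tau0 : 0 < tau.

Lemma alpha_ge0 : 0 <= al.
Proof. by apply: mulr_ge0; [rewrite divr_ge0 ?subr_ge0|exact: ltW]. Qed.

Lemma be_anti r r' : r <= r' -> sinh (be r') <= sinh (be r).
Proof. by move=> rr; rewrite ler_sinh lerB// ler_wpM2l. Qed.

(** For [k > 0], [|S| = S] grows and [be] decreases with the time [r] spent in
    mode 2, so the longest admissible time is the worst one. *)
Lemma stabilizes_pos : 0 < k ->
  k * eta * cosh al <= sinh (be eta) - sinh al -> stabilizes A1 A2 eta tau.
Proof.
move=> k0 Ele; have C0 := cosh_gt0 al; have s0 := sinh_ge0 alpha_ge0.
have SE r : 0 <= r -> `|S r| = S r.
  by move=> r0; rewrite ger0_norm// addr_ge0// !mulr_ge0 ?(ltW k0) ?(ltW C0).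
have kC : 0 < k * cosh al by rewrite mulr_gt0.
have Seta : S eta <= sinh (be eta) by rewrite /S; lra.
apply: stabilizes_coupled => r /andP[r0 re]; rewrite SE//.
  apply: le_trans (be_anti re); apply: le_trans Seta.
  by rewrite lerD2l -!mulrA ler_wpM2r// ltW.
apply: lt_le_trans (be_anti (ltW re)); apply: lt_le_trans Seta.
by rewrite ltrD2l -!mulrA ltr_pM2r.
Qed.

(** For [k < 0], [- S] grows with [r] while [be] decreases, so the bound on
    [- S] is worst at [eta]. The bound on [S] is not monotonic in [r]: it is
    clear while [be r] is at least [al]; after that
    [sinh al - sinh (be r) <= (al - be r) * cosh al < n * r * cosh al], and
    [n <= - k]. *)
Lemma stabilizes_neg : k < 0 -> k <= - n \/ al <= be eta ->
  - k * eta * cosh al <= sinh (be eta) + sinh al -> stabilizes A1 A2 eta tau.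
Proof.
move=> k0 kn Ele; have C0 := cosh_gt0 al; have s0 := sinh_ge0 alpha_ge0.
have kC : 0 < - k * cosh al by rewrite mulr_gt0// oppr_gt0.
have be0 : be 0 = al + p * tau by rewrite /be /al; field.
have pt : 0 < p * tau by exact: mulr_gt0.
have below r : 0 <= r <= eta -> S r < sinh (be r).
  move=> /andP[r0 re]; have rkC : 0 <= r * (- k * cosh al).
    by rewrite mulr_ge0// ltW.
  have [ab|ba] := leP al (be r).
    have := ab; rewrite -ler_sinh => sab.
    move: r0; rewrite le_eqVlt => /predU1P[r0|r0].
      have : sinh al < sinh (be r) by rewrite ltr_sinh -r0 be0; lra.
      rewrite /S -r0; lra.
    have : 0 < r * (- k * cosh al) by rewrite mulr_gt0.
    rewrite /S; lra.
  have kn' : k <= - n.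
    case: kn => // aeta; exfalso.
    have : be eta <= be r by rewrite -ler_sinh; exact: be_anti.
    lra.
  have nab : `|be r| <= al.
    rewrite ler_norml (ltW ba) andbT -ler_sinh sinhN.
    have : sinh (be eta) <= sinh (be r) by exact: be_anti.
    have : 0 <= eta * (- k * cosh al) by rewrite mulr_ge0 ?(ltW eta0) ?(ltW kC).
    lra.
  have := sinhB_le nab.
  rewrite (_ : al - be r = n * r - p * tau); last by rewrite /al /be; field.
  have : 0 <= (- n - k) * (r * cosh al).
    by rewrite mulr_ge0 ?subr_ge0// mulr_ge0// ltW.
  have : 0 < p * tau * cosh al by rewrite mulr_gt0.
  rewrite /S; lra.
have above r r' : (r' - r) * (- k * cosh al) - S r = - S r'.
  by rewrite /S; ring.
have Seta : - S eta <= sinh (be eta) by rewrite /S; lra.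
apply: stabilizes_coupled => r /andP[r0 re].
  rewrite ler_norml (ltW (below _ _)) ?r0// andbT.
  have := be_anti re; have := above r eta.
  have : 0 <= (eta - r) * (- k * cosh al) by rewrite mulr_ge0 ?subr_ge0 ?(ltW kC).
  lra.
rewrite ltr_norml below ?r0 ?(ltW re)// andbT.
have := be_anti (ltW re); have := above r eta.
have : 0 < (eta - r) * (- k * cosh al) by rewrite mulr_gt0 ?subr_gt0.
lra.
Qed.

End Coupled.

(** * The stabilization theorem *)

Theorem theorem11p1 (R : realType) (A1 A2 P1 P2 : 'M[R]_2)
    (p1 q1 n2 a b c d eta : R)
    (hp1 : 0 < p1) (hpq : p1 <= q1) (hn2 : 0 <= n2)
    (hP1 : P1 \in unitmx) (hP2 : P2 \in unitmx)
    (hA1 : A1 = P1 *m mx2 (- p1) 0 0 (- q1) *m invmx P1)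
    (hA2 : A2 = P2 *m mx2 n2 1 0 n2 *m invmx P2)
    (hM : invmx P2 *m P1 = mx2 a b c d)
    (hdet : \det (mx2 a b c d) = 1)
    (heta : 0 < eta) :
  let cd := c * d in
  let stabilizing (tau : R) :=
    (forall s : signal R, dwell_class tau eta s -> stable A1 A2 s) /\
    (forall s : signal R, dwell_class' tau eta s ->
       asymptotically_stable A1 A2 s) in
  let eq_ii (t : R) :=
    `|cd| * eta * cosh ((q1 - p1) / 2 * t) =
    - sinh (n2 * eta - (q1 + p1) / 2 * t)
    - Num.sg cd * sinh ((q1 - p1) / 2 * t) in
  let eq_plus (t : R) :=
    sinh ((q1 - p1) / 2 * t) = sinh ((q1 + p1) / 2 * t - n2 * eta) in
  let eq_minus (t : R) :=
    cd * eta * cosh ((q1 - p1) / 2 * t) =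
    - sinh ((q1 - p1) / 2 * t) - sinh ((q1 + p1) / 2 * t - n2 * eta) in
  [/\ cd = 0 ->
        forall eps0 : R, 0 < eps0 -> stabilizing (n2 / p1 * eta + eps0),
      cd != 0 -> cd \notin `]- n2, 0] ->
        (exists! t : R, 0 < t /\ eq_ii t) /\
        (forall tau : R, 0 < tau -> eq_ii tau -> stabilizing tau)
    & cd \in `]- n2, 0[ ->
        [/\ exists! t : R, 0 < t /\ eq_plus t,
            exists! t : R, 0 < t /\ eq_minus t
          & forall tau_plus tau_minus : R,
              0 < tau_plus -> eq_plus tau_plus ->
              0 < tau_minus -> eq_minus tau_minus ->
              stabilizing (Num.max tau_plus tau_minus)]].
Proof.
move=> cd stabilizing eq_ii eq_plus eq_minus.
have n2eta : 0 <= n2 * eta by rewrite mulr_ge0// ltW.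
have coupled : cd != 0 -> exists Q : 'M[R]_2, [/\ Q \in unitmx,
    Q *m A1 = mx2 (- p1) 0 0 (- q1) *m Q &
    Q *m A2 = mx2 (n2 + cd) cd (- cd) (n2 - cd) *m Q].
  rewrite mulf_eq0 => /norP[c0 d0].
  have [Q [Qu QA1 QA2]] := normal_form hP1 hP2 hA1 hA2 hM hdet c0 d0.
  exists Q; split=> //; rewrite QA2 -/cd; congr (mx2 _ _ _ _ *m _).
    by rewrite /cd; field.
  by rewrite /cd; field.
pose x t := (q1 - p1) / 2 * t.
pose y t := (q1 + p1) / 2 * t - n2 * eta.
have eq_iiE t : eq_ii t <->
    `|cd| * eta * cosh (x t) = sinh (y t) + - Num.sg cd * sinh (x t).
  by rewrite /eq_ii -[n2 * eta - _]opprB sinhN opprK mulNr.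
have eq_minusE t : eq_minus t <->
    - cd * eta * cosh (x t) = sinh (y t) + 1 * sinh (x t).
  by rewrite /eq_minus -/(x t) -/(y t); split=> E; lra.
have eq_plusE t : eq_plus t <-> p1 * t = n2 * eta.
  by split=> [/sinh_inj E|E]; [lra|rewrite /eq_plus; congr sinh; lra].
split.
- move=> cd0 eps eps0.
  pose nu := (1 - expR (- (p1 * eps))) / (2 * eta).
  have nu0 : 0 < nu.
    by rewrite divr_gt0 ?mulr_gt0// subr_gt0 -(expR0 R) ltr_expR oppr_lt0 mulr_gt0.
  have nuN : `|nu| <= nu by rewrite gtr0_norm.
  have zN : `|0 : R| <= nu by rewrite normr0 ltW.
  have [c0|c0] := eqVneq c 0.
    have d0 : d != 0.
      apply: contra_eq_neq hdet => d0.
      by rewrite det_mx2 c0 d0 !mulr0 subr0 eq_sym oner_eq0.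
    have u0 : nu / d ^+ 2 != 0 by rewrite mulf_neq0 ?invr_neq0 ?expf_neq0// lt0r_neq0.
    have [Q [Qu QA1 QA2]] := normal_form hP1 hP2 hA1 hA2 hM hdet u0 (oner_neq0 R).
    apply: (stabilizes_triangular hp1 hpq hn2 heta _ Qu QA1 QA2 eps0).
    + by rewrite -/cd cd0 c0; field; rewrite d0 gt_eqF.
    + by [].
    + by rewrite (_ : _ / 1 = nu) ?nuN//; field.
    + by rewrite c0 expr0n /= !mul0r.
  have d0 : d = 0 by move/eqP: cd0; rewrite mulf_eq0 (negPf c0) => /eqP.
  have v0 : nu / c ^+ 2 != 0 by rewrite mulf_neq0 ?invr_neq0 ?expf_neq0// lt0r_neq0.
  have [Q [Qu QA1 QA2]] := normal_form hP1 hP2 hA1 hA2 hM hdet (oner_neq0 R) v0.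
  apply: (stabilizes_triangular hp1 hpq hn2 heta _ Qu QA1 QA2 eps0).
  + by rewrite d0 mulr0 expr0n /= !mul0r.
  + by [].
  + by rewrite d0 expr0n /= !mul0r.
  + by rewrite (_ : _ / 1 = nu) ?nuN//; field.
- move=> cd0 cdn; have L0 : 0 < `|cd| * eta by rewrite mulr_gt0 ?normr_gt0.
  have sg1 : -1 <= - Num.sg cd /\ - Num.sg cd <= 1.
    by case: sgrP cd0 => // _ _; rewrite ?opprK; split; lra.
  split.
    have [t [tP tU]] :=
      threshold_exists_unique hp1 hpq n2eta L0 sg1.1.
    exists t; split=> [|t' [t'0 /eq_iiE t'E]]; last exact: tU.
    by case: tP => ? ?; split=> //; apply/eq_iiE.
  move=> tau tau0 /eq_iiE tauE.
  have [Q [Qu QA1 QA2]] := coupled cd0.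
  have [cdneg|cdpos|cdeq] := ltgtP cd 0; last by rewrite cdeq eqxx in cd0.
    apply: (stabilizes_neg hp1 hpq hn2 heta Qu QA1 QA2 tau0 cdneg).
      by left; move: cdn; rewrite in_itv /= (ltW cdneg) andbT -leNgt.
    by move: tauE; rewrite ltr0_norm// ltr0_sg// opprK mul1r /x /y => ->.
  apply: (stabilizes_pos hp1 hpq hn2 Qu QA1 QA2 tau0 cdpos).
  by move: tauE; rewrite gtr0_norm// gtr0_sg// mulN1r /x /y => ->.
move=> /[!in_itv] /= /andP[cdn cdneg].
have n20 : 0 < n2 by lra.
have L0 : 0 < - cd * eta by rewrite mulr_gt0// oppr_gt0.
have N11 : -1 <= (1 : R) by lra.
split.
- exists (n2 * eta / p1); split=> [|t [_ /eq_plusE <-]].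
    split; first by rewrite divr_gt0 ?mulr_gt0.
    by apply/eq_plusE; field; rewrite gt_eqF.
  by field; rewrite gt_eqF.
- have [t [tP tU]] := threshold_exists_unique hp1 hpq n2eta L0 N11.
  exists t; split=> [|t' [t'0 /eq_minusE t'E]]; last exact: tU.
  by case: tP => ? ?; split=> //; apply/eq_minusE.
move=> tp tm tp0 /eq_plusE tpE tm0 /eq_minusE tmE.
set tau := Num.max tp tm.
have tau0 : 0 < tau by rewrite lt_max tp0.
have cd0 : cd != 0 by rewrite lt_eqF.
have [Q [Qu QA1 QA2]] := coupled cd0.
apply: (stabilizes_neg hp1 hpq hn2 heta Qu QA1 QA2 tau0 cdneg).
  right; have : p1 * tp <= p1 * tau by rewrite ler_pM2l// le_max lexx.
  lra.
have tmtau : tm <= tau by rewrite le_max lexx orbT.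
have := threshold_le hp1 hpq N11 tmtau tmE.
by rewrite mul1r.
Qed.
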